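(* Let $d\geq 2$. There exist constants $c_1,c_2>0$ depending only on $d$ such that for every odd prime power $q$ and every $t\in\mathbb{F}_q\setminus\{0\}$ there exists a set $E\subset \mathbb{F}_q^d$ (depending on $t$) with $c_1q^{d-1}\leq |E|\leq c_2 q^{d-1}$ such that the VC-dimension of the $t$-distance graph $G_t(E)$ is at most $d-1$.
   Context: For $x,y\in\mathbb{F}_q^d$ write $\|x-y\|=\sum_{i=1}^d (x_i-y_i)^2\in\mathbb{F}_q$. For $E\subset\mathbb{F}_q^d$ and $t\in\mathbb{F}_q$, the $t$-distance graph $G_t(E)$ is the graph with vertex set $E$ in which $x\sim y$ if and only if $\|x-y\|=t$. VC-dimension: if $V$ is a set and $\mathcal{H}\subset\{0,1\}^V$ is a family of functions, $\mathcal{H}$ shatters a finite set $S\subset V$ if $\{0,1\}^S=\{h|_S:h\in\mathcal{H}\}$; the VC-dimension of $\mathcal{H}$ is the largest integer $n$ such that $\mathcal{H}$ shatters some set of size $n$ (infinite if no such $n$ exists). For a graph with vertex set $V$ and adjacency relation $\sim$, the neighborhood of $x\in V$ is $N(x)=\{y\in V:x\sim y\}$ and the closed neighborhood of $x$ is $N[x]=\{x\}\cup N(x)$. The VC-dimension of the graph is the VC-dimension of the family $\{\mathbf{1}_{N[x]}:x\in V\}$ of indicator functions of closed neighborhoods. *)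

(* Defs.v *)
From HB Require Import structures.
From mathcomp Require Import all_boot all_order all_algebra.
From mathcomp Require Import reals.

Set Implicit Arguments.
Unset Strict Implicit.
Unset Printing Implicit Defensive.

Import Order.TTheory GRing.Theory Num.Theory.
Local Open Scope ring_scope.

Definition restrict (V : finType) (S : {set V}) (h : {ffun V -> bool}) :
    {ffun {x : V | x \in S} -> bool} :=
  [ffun x => h (val x)].

Definition shatters (V : finType) (H : {set {ffun V -> bool}}) (S : {set V}) : bool :=
  [set restrict S h | h in H] == [set: {ffun {x : V | x \in S} -> bool}].

(* As V is finite the largest size always exists, so the value is a natural
   number; an empty family shatters nothing and gets the value 0. *)
Definition vc_dim (V : finType) (H : {set {ffun V -> bool}}) : nat :=
  \max_(S : {set V} | shatters H S) #|S|.

Definition nbhd (V : finType) (e : rel V) (x : V) : {set V} := [set y | e x y].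

Definition closed_nbhd (V : finType) (e : rel V) (x : V) : {set V} :=
  x |: nbhd e x.

Definition indicator (V : finType) (A : {set V}) : {ffun V -> bool} :=
  [ffun y => y \in A].

Definition graph_vc_dim (V : finType) (e : rel V) : nat :=
  vc_dim [set indicator (closed_nbhd e x) | x : V].

Definition sqdist (F : finFieldType) (d : nat) (x y : 'rV[F]_d) : F :=
  \sum_(i < d) (x ord0 i - y ord0 i) ^+ 2.

(* The vertex type is the subtype of elements of E, so that both the shattered
   sets and the centres of the neighborhoods are confined to E. *)
Definition dist_graph (F : finFieldType) (d : nat) (E : {set 'rV[F]_d}) (t : F) :
    rel {x : 'rV[F]_d | x \in E} :=
  fun x y => sqdist (val x) (val y) == t.

(* Main.v *)
(** Put [r := t / 2].  For [x], [y] on the sphere [<x, x> = r] one has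
    [||x - y|| = t] if and only if [<x, y> = 0], so on the sphere the distance
    graph is the orthogonality graph.  If [d] points were shattered by open
    neighborhoods they would be linearly independent and have a common
    orthogonal vector on the sphere, which is absurd since [r <> 0].

    With closed neighborhoods a center may belong to the shattered set, and the
    claim is false for the whole sphere because of antipodal pairs (when [d = 2],
    two orthogonal points can be shattered).  So [E] is a subset of the sphere
    without antipodal pairs, i.e. without distinct collinear points, truncated
    to at most [q ^ (d - 1)] points. *)
Require Import Defs.
From HB Require Import structures.
From mathcomp Require Import all_boot all_order all_algebra.
From mathcomp Require Import reals.
From mathcomp Require Import fingroup cyclic finfield zify ring.

Set Implicit Arguments.
Unset Strict Implicit.
Unset Printing Implicit Defensive.

Import Order.TTheory GRing.Theory Num.Theory.
Local Open Scope ring_scope.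

(** * The dot product on row vectors *)

Section DotProduct.
Variables (F : fieldType) (d : nat).
Implicit Types (u v w : 'rV[F]_d) (a : F).

Definition dotv u v : F := (u *m v^T) ord0 ord0.

Lemma dotvE u v : dotv u v = \sum_i u ord0 i * v ord0 i.
Proof. by rewrite /dotv mxE; apply: eq_bigr => i _; rewrite mxE. Qed.

Lemma dotvC u v : dotv u v = dotv v u.
Proof. by rewrite !dotvE; apply: eq_bigr => i _; rewrite mulrC. Qed.

Lemma dotvDl u v w : dotv (u + v) w = dotv u w + dotv v w.
Proof. by rewrite /dotv mulmxDl mxE. Qed.

Lemma dotvZl a u v : dotv (a *: u) v = a * dotv u v.
Proof. by rewrite /dotv -scalemxAl mxE. Qed.

Lemma dotvNl u v : dotv (- u) v = - dotv u v.
Proof. by rewrite -scaleN1r dotvZl mulN1r. Qed.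

Lemma dotvDr u v w : dotv w (u + v) = dotv w u + dotv w v.
Proof. by rewrite !(dotvC w) dotvDl. Qed.

Lemma dotvZr a u v : dotv v (a *: u) = a * dotv v u.
Proof. by rewrite !(dotvC v) dotvZl. Qed.

Lemma dotvNr u v : dotv v (- u) = - dotv v u.
Proof. by rewrite !(dotvC v) dotvNl. Qed.

Lemma dotv0l v : dotv 0 v = 0.
Proof. by rewrite /dotv mul0mx mxE. Qed.

Lemma dotv_suml n (f : 'I_n -> 'rV[F]_d) v :
  dotv (\sum_j f j) v = \sum_j dotv (f j) v.
Proof. by rewrite /dotv mulmx_suml summxE. Qed.

(** Comparing norms gives [a ^+ 2 = 1]. *)
Lemma scale_same_norm u v a :
  dotv u u != 0 -> dotv v v = dotv u u -> v = a *: u -> v = u \/ v = - u.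
Proof.
move=> u0 vu va; have : (a ^+ 2 == 1 ^+ 2).
  apply/eqP/(mulIf u0); rewrite expr1n mul1r -[RHS]vu {1}va.
  by rewrite va !dotvZl !dotvZr; ring.
by rewrite eqf_sqr va => /orP[]/eqP->; rewrite ?scaleN1r ?scale1r; [left|right].
Qed.

End DotProduct.

(** * Orthogonality and linear independence *)

Section Independence.
Variables (F : fieldType) (d : nat) (y : 'I_d -> 'rV[F]_d).

Lemma orthogonal_basis_eq0 (w : 'rV[F]_d) :
    (forall a : 'I_d -> F, \sum_j a j *: y j = 0 -> forall j, a j = 0) ->
  (forall j, dotv w (y j) = 0) -> w = 0.
Proof.
move=> yfree wy; pose Y : 'M[F]_d := \matrix_j y j.
have uY : row_free Y.
  apply/row_freeP; exists (invmx Y); apply: mulmxV.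
  rewrite -row_free_unit -kermx_eq0; apply/eqP/row_matrixP => i.
  have : row i (kermx Y) *m Y = 0 by rewrite -row_mul mulmx_ker row0.
  rewrite row0 mulmx_sum_row => k0; apply/rowP => j; rewrite [RHS]mxE.
  apply: (yfree (fun j => row i (kermx Y) ord0 j)).
  by rewrite -[RHS]k0; apply: eq_bigr => l _; rewrite rowK.
have wY : w *m Y^T = 0.
  apply/rowP => j; rewrite [RHS]mxE -(wy j) /dotv [LHS]mxE [RHS]mxE.
  by apply: eq_bigr => l _; rewrite !mxE.
move: uY; rewrite row_free_unit -unitmx_tr => uY.
by rewrite -(mulmxK uY w) wY mul0mx.
Qed.

Lemma orthogonal_dependent (x : 'rV[F]_d) :
    x != 0 -> (forall j, dotv x (y j) = 0) ->
  exists2 a : 'I_d -> F, \sum_j a j *: y j = 0 & exists j, a j != 0.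
Proof.
move=> x0 xy; pose Y : 'M[F]_d := \matrix_j y j.
have xY : x *m Y^T = 0.
  apply/rowP => j; rewrite [RHS]mxE -(xy j) /dotv [LHS]mxE [RHS]mxE.
  by apply: eq_bigr => l _; rewrite !mxE.
have : ~~ row_free Y.
  rewrite row_free_unit -unitmx_tr; apply: contra x0 => uY.
  by rewrite -(mulmxK uY x) xY mul0mx.
rewrite -kermx_eq0 => /rowV0Pn[v /sub_kermxP vY /rV0Pn v0].
exists (fun j => v ord0 j) => //; rewrite -[RHS]vY mulmx_sum_row.
by apply: eq_bigr => l _; rewrite rowK.
Qed.

End Independence.

(** * Impossibility of shattering [d] points of the sphere in dimension [d] *)

Section NoShattering.
Variables (F : fieldType) (d : nat) (r : F) (E : {pred 'rV[F]_d}).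
Hypothesis r0 : r != 0.
Hypothesis normE : forall x, x \in E -> dotv x x = r.
Hypothesis antiE : forall x, x \in E -> - x \notin E.
Variables (y : 'I_d -> 'rV[F]_d) (c : {set 'I_d} -> 'rV[F]_d).
Hypotheses (y_inj : injective y) (yE : forall j, y j \in E).
Hypothesis cE : forall B, c B \in E.
(** The first alternative covers a center that is itself one of the points, as closed neighborhoods
    allow. *)
Hypothesis cP :
  forall B j, (c B == y j) || (dotv (c B) (y j) == 0) = (j \in B).

Let E_collinear u v a : u \in E -> v \in E -> v = a *: u -> v = u.
Proof.
move=> uE vE va; have [||//|vN] := scale_same_norm _ _ va.
- by rewrite normE.
- by rewrite !normE.
- by move: (antiE uE); rewrite -vN vE.
Qed.

Let center_zero (B : {set 'I_d}) j : c B != y j -> j \in B -> dotv (c B) (y j) = 0.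
Proof. by move=> /negPf cj; rewrite -cP cj => /eqP. Qed.

Let center_nonzero (B : {set 'I_d}) j : j \notin B -> dotv (c B) (y j) != 0.
Proof. by rewrite -cP negb_or => /andP[]. Qed.

Let own_center (B : {set 'I_d}) k : c B = y k -> k \in B.
Proof. by move=> ck; rewrite -cP ck eqxx. Qed.

Let dot_relation a v : \sum_j a j *: y j = 0 -> \sum_j a j * dotv v (y j) = 0.
Proof.
move=> a0; rewrite -[RHS](dotv0l v) -[in RHS]a0 dotv_suml.
by apply: eq_bigr => j _; rewrite dotvZl dotvC.
Qed.

Let dot_relation1 a v i : \sum_j a j *: y j = 0 ->
  (forall j, j != i -> a j * dotv v (y j) = 0) -> a i * dotv v (y i) = 0.
Proof.
by move=> /(dot_relation v); rewrite (bigD1 i) //= => + z; rewrite big1 ?addr0.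
Qed.

(* Otherwise [y i0] is orthogonal to all the other points, the points form a
   basis, and the center of the complement of [i0] is a multiple of [y i0]. *)
Let center_of_all_outside i0 : c setT != y i0.
Proof.
apply/eqP => c0.
have y0 j : j != i0 -> dotv (y i0) (y j) = 0.
  move=> ji; rewrite -c0; apply: center_zero; last by rewrite inE.
  by rewrite c0 inj_eq // eq_sym.
(* A center of the form [y j] equals [y i0] or is orthogonal to it, and either would put [i0] in
   [B]. *)
have outside (B : {set 'I_d}) j : i0 \notin B -> c B != y j.
  move=> iB; apply: contraNneq iB => cj; have [<-|ji] := eqVneq j i0.
    exact: own_center cj.
  by rewrite -cP cj dotvC y0 // eqxx orbT.
have yfree a : \sum_j a j *: y j = 0 -> forall j, a j = 0.
  move=> a0; have ai0 : a i0 = 0.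
    apply: (mulIf r0); rewrite mul0r -(normE (yE i0)).
    by apply: (dot_relation1 a0) => j ji; rewrite y0 ?mulr0.
  move=> i; have [->//|ii0] := eqVneq i i0.
  (* By [outside], [c B] is orthogonal to all points except possibly [y i0] and [y i]; as
     [a i0 = 0], pairing the relation with [c B] leaves only the term at [i]. *)
  pose B := ~: [set i0; i].
  have iB : i \notin B by rewrite !inE eqxx orbT.
  have i0B : i0 \notin B by rewrite !inE eqxx.
  apply: (mulIf (center_nonzero iB)); rewrite mul0r.
  apply: (dot_relation1 a0) => j ji; have [->|ji0] := eqVneq j i0.
    by rewrite ai0 mul0r.
  rewrite center_zero ?mulr0 ?outside //.
  by rewrite !inE negb_or ji0 ji.
pose B := ~: [set i0]; have i0B : i0 \notin B by rewrite !inE eqxx.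
have /eqP[] := outside B i0 i0B.
(* The scalar is the coefficient of the orthogonal projection of [c B] onto [y i0]; the remainder is
   orthogonal to the whole basis. *)
apply: (@E_collinear _ _ (dotv (c B) (y i0) / r)) => //.
apply/eqP; rewrite -subr_eq0; apply/eqP.
apply: (orthogonal_basis_eq0 yfree) => j.
rewrite dotvDl dotvNl dotvZl; have [->|ji] := eqVneq j i0.
  by rewrite normE // divfK // subrr.
by rewrite y0 // mulr0 subr0 center_zero ?outside // !inE.
Qed.

(** Otherwise pairing the relation with [c B] leaves only the term at [i], where [dotv (c B) (y i)]
    is nonzero. *)
Let relation_center a i (B : {set 'I_d}) :
    \sum_j a j *: y j = 0 -> a i != 0 -> i \notin B ->
    (forall j, a j != 0 -> j != i -> j \in B) ->
  exists2 k, c B = y k & a k != 0.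
Proof.
move=> a0 ai iB suppB.
case: (pickP [pred k | (c B == y k) && (a k != 0)]) => [k|nok].
  by move=> /= /andP[/eqP ck ak]; exists k.
case/eqP: ai; apply: (mulIf (center_nonzero iB)); rewrite mul0r.
apply: (dot_relation1 a0) => j ji; have [->|aj] := eqVneq (a j) 0.
  by rewrite mul0r.
rewrite center_zero ?mulr0 ?suppB //.
by move: (nok j); rewrite /= aj andbT => ->.
Qed.

(* If [i] is in the support of a relation then the center of [~: [set i]] is
   [y (k i)] for some [k i] in the support.  As [k] is injective it permutes the
   support, so no [y j] with [j] in the support is the center of a further set;
   if the support were not full, [relation_center] would give such a set. *)
Let relation_full_support a :
    \sum_j a j *: y j = 0 -> (exists j, a j != 0) ->
  (forall j, a j != 0) /\
  exists2 k : 'I_d -> 'I_d, injective k & forall i, c (~: [set i]) = y (k i).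
Proof.
move=> a0 [i0 ai0]; pose A := [set j | a j != 0].
(* For [i] in [A] the pick succeeds by [relation_center], so the default is not reached there. *)
pose k i := odflt i [pick l | c (~: [set i]) == y l].
have kP i : i \in A -> c (~: [set i]) = y (k i) /\ k i \in A.
  rewrite inE => ai; have [||l cl al] := @relation_center _ i (~: [set i]) a0 ai.
  - by rewrite !inE eqxx.
  - by move=> j _; rewrite !inE.
  rewrite /k; case: pickP => [m /eqP cm|/(_ l)]; last by rewrite cl eqxx.
  by split=> //=; rewrite -(y_inj (etrans (esym cl) cm)) inE.
have k_inj : {in A &, injective k}.
  move=> i j iA jA kij; apply/eqP.
  have := cP (~: [set i]) i.
  by rewrite (kP i iA).1 kij -(kP j jA).1 cP !inE eqxx => /negbFE.
have kA : k @: A = A.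
  apply/eqP; rewrite eqEcard card_in_imset // leqnn andbT.
  by apply/subsetP => _ /imsetP[i iA ->]; case: (kP i iA).
have full l : l \in A.
  apply/negPn/negP => lA.
  have [||m cm am] := @relation_center _ i0 (A :\ i0) a0 ai0.
  - by rewrite !inE eqxx.
  - by move=> j aj ji; rewrite !inE aj ji.
  have : m \in k @: A by rewrite kA inE.
  case/imsetP => j jA mj.
  (* Here [y m] is the center of both [A :\ i0] and [~: [set j]]. The first set misses [l], hence so
     does the second, and [l = j] lies in [A]. *)
  have := cP (A :\ i0) l.
  rewrite cm mj -(kP j jA).1 cP in_setC in_set1 in_setD1 (negPf lA) andbF.
  by move=> /negbFE/eqP lj; move: lA; rewrite lj jA.
split=> [j|]; first by move: (full j); rewrite inE.
by exists k => [i j|i]; [apply: k_inj | case: (kP i)].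
Qed.

(** The vector [c setT] is orthogonal to all [d] points, so they satisfy a relation, necessarily of
    full support. The permutation [k] then pairs [i] with [k i], and this pair is orthogonal to all
    other points. *)
Lemma not_shattered : False.
Proof.
set x0 := c setT.
have x0n : x0 != 0.
  by apply: contraNneq r0 => x00; rewrite -(normE (cE setT)) -/x0 x00 dotv0l.
have x0y j : dotv x0 (y j) = 0 by rewrite center_zero ?inE.
have [a a0 aN] := orthogonal_dependent x0n x0y.
have [aF [k k_inj kc]] := relation_full_support a0 aN.
have [i _] := aN.
have ki : k i != i by have := own_center (kc i); rewrite !inE.
have yk0 j : j != i -> j != k i -> dotv (y (k i)) (y j) = 0.
  by move=> ji jk; rewrite -kc center_zero ?kc ?inj_eq 1?eq_sym // !inE.
have yki : dotv (y (k i)) (y i) != 0.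
  by rewrite -kc center_nonzero // !inE eqxx.
(* By surjectivity of [k], [y i] is the center of some [~: [set i']]; not being orthogonal to
   [y (k i)], it forces [i' = k i]. *)
have yi0 j : j != i -> j != k i -> dotv (y i) (y j) = 0.
  have : i \in codom k by rewrite (injF_onto k_inj).
  case/codomP => i' ii' ji jk.
  have ki' : k i = i'.
    apply/eqP; apply: contraNT yki => ki'.
    by rewrite dotvC {1}ii' -kc center_zero // ?inE // kc -ii' inj_eq // eq_sym.
  rewrite {1}ii' -kc center_zero //; last by rewrite !inE -ki'.
  by rewrite kc -ii' inj_eq // eq_sym.
(* Being orthogonal to every [y j] and to [x0], the partial sum [w] of the
   relation vanishes, which makes [y i] and [y (k i)] collinear. *)
pose w := a i *: y i + a (k i) *: y (k i).
have wv v : (forall j, j != i -> j != k i -> dotv v (y j) = 0) -> dotv w v = 0.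
  move=> vy; have := dot_relation v a0.
  rewrite (bigD1 i) //= (bigD1 (k i)) //= big1 => [|j /andP[ji jk]].
    by rewrite addr0 dotvDl !dotvZl !(dotvC v).
  by rewrite vy ?mulr0.
have w0 : w = 0.
  (* Replacing [y i] by [x0] gives a basis: pairing a relation with [x0] kills the coefficient at
     [i], while a nontrivial relation among the [y j] has no zero coefficient. *)
  apply: (@orthogonal_basis_eq0 _ _ (fun j => if j == i then x0 else y j)).
    move=> b b0.
    have bi : b i = 0.
      apply: (mulIf r0); rewrite mul0r -(normE (cE setT)) -/x0.
      rewrite -[RHS](dotv0l x0) -[in RHS]b0 dotv_suml (bigD1 i) //= eqxx dotvZl.
      rewrite big1 ?addr0 // => j /negPf ->.
      by rewrite dotvZl dotvC x0y mulr0.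
    have b0' : \sum_j b j *: y j = 0.
      rewrite -[RHS]b0; apply: eq_bigr => j _.
      by case: eqVneq => [->|//]; rewrite bi !scale0r.
    move=> j; apply/eqP/negPn/negP => bj.
    by have [/(_ i)] := relation_full_support b0' (ex_intro _ j bj); rewrite bi eqxx.
  move=> j; have [_|ji] := eqVneq j i; first by apply: wv => l _ _; exact: x0y.
  have [->|jk] := eqVneq j (k i); first exact: wv.
  by rewrite dotvDl !dotvZl yi0 // yk0 // !mulr0 addr0.
have /E_collinear : y (k i) = (- a i / a (k i)) *: y i.
  apply: (scalerI (aF (k i))); rewrite scalerA mulrC divfK // scaleNr.
  by apply/eqP; rewrite -addr_eq0 addrC -/w w0.
by move=> /(_ (yE i) (yE (k i)))/y_inj/eqP; rewrite (negPf ki).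
Qed.

End NoShattering.

(** * Lower bound for the size of a sphere *)

Section SphereCount.
Variable F : finFieldType.
Hypothesis oddF : odd #|F|.
Local Notation q := #|F|.

Let q_ge3 : (3 <= q)%N.
Proof. by have := finNzRing_gt1 F; move: oddF; case: q => [|[|[|]]]. Qed.

(** The odd number [q] vanishes in [F], so [2 = 0] would give [1 = 0]. *)
Lemma odd_two_neq0 : 2%:R != 0 :> F.
Proof.
apply/negP => /eqP two0.
have q0 : #|F|%:R = 0 :> F by rewrite -cardsT; exact: (@expg_cardG F (setT_group F) 1%R (in_setT _)).
have /eqP[] := oner_neq0 F.
by rewrite -[RHS]q0 -(odd_double_half q) oddF -muln2 natrD natrM two0 mulr0 addr0.
Qed.

Lemma card_square_roots (c : F) : (#|[set y : F | y ^+ 2 == c]| <= 2)%N.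
Proof.
have [->|[s]] := set_0Vmem [set y : F | y ^+ 2 == c]; first by rewrite cards0.
rewrite inE => /eqP sc; apply: (@leq_trans #|[set s; - s]|); last first.
  by rewrite cards2; case: (_ != _).
by apply/subset_leq_card/subsetP => y; rewrite !inE -sc eqf_sqr.
Qed.

(** Pigeonhole: the set [S] of squares and its reflection [T] both have more than [q / 2] elements,
    so they meet. *)
Lemma sum_two_squares (t : F) : exists a b : F, a ^+ 2 + b ^+ 2 = t.
Proof.
pose S := [set x ^+ 2 | x : F]; pose T := [set t - s | s in S].
have cT : #|T| = #|S| by rewrite card_imset // => u v /addrI/oppr_inj.
have qS : (q <= #|S| * 2)%N.
  rewrite -[leqLHS]sum1_card (partition_big (fun x => x ^+ 2) (mem S)) /=; last first.
    by move=> x _; apply: imset_f.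
  rewrite -sum_nat_const; apply: leq_sum => c _.
  by rewrite sum1_card -cardsE card_square_roots.
have qST : (#|S| * 2 != q)%N by apply: contraTneq oddF => <-; rewrite oddM andbF.
have : (0 < #|S :&: T|)%N.
  have := cardsUI S T; have := max_card (mem (S :|: T)).
  have : (q < #|S| * 2)%N by rewrite ltn_neqAle eq_sym qST.
  rewrite cT; move: #|S :|: T| #|S :&: T| #|S| #|F| => u v w k; lia.
rewrite card_gt0 => /set0Pn[u /setIP[/imsetP[a _ ->] /imsetP[_ /imsetP[b _ ->]]]].
by move=> ab; exists a, b; rewrite ab subrK.
Qed.

Definition circle (r : F) : {set F * F} :=
  [set p | p.1 ^+ 2 + p.2 ^+ 2 == r].

(* Multiply by a + ib, where a ^ 2 + b ^ 2 = r / s. *)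
Lemma leq_card_circle (r s : F) :
  r != 0 -> s != 0 -> (#|circle s| <= #|circle r|)%N.
Proof.
move=> r0 s0; have [a [b abE]] := sum_two_squares (r / s).
pose f (p : F * F) := (a * p.1 - b * p.2, b * p.1 + a * p.2).
have f_inj : injective f.
  move=> [x1 x2] [y1 y2] [e1 e2].
  have n0 : a ^+ 2 + b ^+ 2 != 0 by rewrite abE mulf_neq0 ?invr_eq0.
  congr pair; apply: (mulfI n0).
    transitivity (a * (a * x1 - b * x2) + b * (b * x1 + a * x2)); first by ring.
    by rewrite e1 e2; ring.
  transitivity (a * (b * x1 + a * x2) - b * (a * x1 - b * x2)); first by ring.
  by rewrite e1 e2; ring.
rewrite -(card_imset _ f_inj); apply/subset_leq_card/subsetP => _ /imsetP[p + ->].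
rewrite !inE => /eqP ps; rewrite -(divfK s0 r) -abE -ps; apply/eqP => /=.
by ring.
Qed.

(** The circles partition the plane: [circle 0] has at most [2 * q] points and the other [q - 1]
    have at most [#|circle r|] each. *)
Lemma card_circle_ge (r : F) : r != 0 -> (q <= 9 * #|circle r|)%N.
Proof.
move=> r0; have q2 : (q * q = \sum_(s : F) #|circle s|)%N.
  rewrite -card_prod -[LHS]sum1_card.
  rewrite (partition_big (fun p : F * F => p.1 ^+ 2 + p.2 ^+ 2) predT) //=.
  by apply: eq_bigr => s _; rewrite sum1_card -cardsE.
have c0 : (#|circle 0%R| <= q * 2)%N.
  rewrite -[#|circle 0|]sum1_card (partition_big (fun p : F * F => p.1) predT) //=.
  rewrite -sum_nat_const; apply: leq_sum => x _; rewrite sum1_card.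
  apply: leq_trans (card_square_roots (- x ^+ 2)).
  rewrite -cardsE -(@card_in_imset _ _ snd); last first.
    move=> [u1 u2] [v1 v2]; rewrite !inE /=.
    by move=> /andP[_ /eqP/= ->] /andP[_ /eqP/= ->] ->.
  apply/subset_leq_card/subsetP => _ /imsetP[[u v] + ->].
  rewrite !inE /= => /andP[+ /eqP/= ux]; rewrite /= ux inE.
  by rewrite addrC addr_eq0.
move: q2; rewrite (bigD1 0) //= => q2.
have le : (\sum_(s : F | s != 0%R) #|circle s| <= q.-1 * #|circle r|)%N.
  have -> : q.-1 = #|[set~ 0 : F]| by rewrite cardsC1.
  rewrite -sum_nat_const; under [leqRHS]eq_bigl do rewrite !inE.
  by apply: leq_sum => s s0; apply: leq_card_circle.
have q3 := q_ge3; have qp : q = q.-1.+1 by rewrite prednK // (leq_trans _ q3).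
move: (leq_trans (eq_leq q2) (leq_add c0 le)) q3; rewrite qp.
move: q.-1 #|circle r| => k m /=.
nia.
Qed.

Definition sphere (n : nat) (r : F) : {set 'rV[F]_n} :=
  [set x | dotv x x == r].

(** Induction by slicing along the first coordinate [a]: the slice is a sphere for [r - a ^+ 2],
    which is nonzero for at least [q - 2 >= q / 3] values of [a]. *)
Lemma card_sphere_ge (n : nat) (r : F) :
  r != 0 -> (q ^ n.+1 <= 3 ^ n.+2 * #|sphere n.+2 r|)%N.
Proof.
elim: n r => [|n IH] r r0.
  rewrite expn1; apply: leq_trans (card_circle_ge r0) _.
  rewrite (leq_mul2l 9) /=.
  pose f (p : F * F) : 'rV[F]_2 := row_mx p.1%:M p.2%:M.
  have f_inj : injective f.
    move=> [u1 u2] [v1 v2] /(@eq_row_mx _ 1 1 1)[/(congr1 (fun A : 'M_1 => A ord0 ord0))].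
    rewrite !mxE !mulr1n /= => -> /(congr1 (fun A : 'M_1 => A ord0 ord0)).
    by rewrite !mxE !mulr1n /= => ->.
  rewrite -(card_imset _ f_inj); apply/subset_leq_card/subsetP.
  move=> _ /imsetP[p + ->]; rewrite !inE => /eqP <-.
  rewrite /dotv (@tr_row_mx _ 1 1 1) (@mul_row_col _ 1 1 1).
  by rewrite !tr_scalar_mx -!scalar_mxM !mxE.
have fiber (a : F) : (#|sphere n.+2 (r - a ^+ 2)%R| <=
    #|[set x in sphere n.+3 r | x ord0 ord0 == a]|)%N.
  pose f (v : 'rV[F]_n.+2) : 'rV[F]_(1 + n.+2) := row_mx a%:M v.
  have f_inj : injective f by move=> u v /(@eq_row_mx _ 1 1)[].
  rewrite -(card_imset _ f_inj); apply/subset_leq_card/subsetP.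
  move=> _ /imsetP[v + ->]; rewrite !inE => /eqP vv; apply/andP; split.
    rewrite /dotv (@tr_row_mx _ 1 1) (@mul_row_col _ 1 1) tr_scalar_mx -scalar_mxM.
    by rewrite mxE [X in _ + X]vv mxE /= -expr2 addrC subrK.
  have e : ord0 = lshift n.+2 (ord0 : 'I_1) :> 'I_(1 + n.+2) by apply: val_inj.
  by apply/eqP; rewrite -[LHS]/(f v ord0 (ord0 : 'I_(1 + n.+2))) e row_mxEl mxE mulr1n.
have -> : #|sphere n.+3 r| =
    (\sum_(a : F) #|[set x in sphere n.+3 r | x ord0 ord0 == a]|)%N.
  rewrite -[LHS]sum1_card (partition_big (fun x : 'rV[F]_n.+3 => x ord0 ord0) predT) //=.
  by apply: eq_bigr => a _; rewrite sum1_card -cardsE; apply: eq_card => x; rewrite !inE.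
pose N := [set a : F | a ^+ 2 != r].
have cN : (q <= 3 * #|N|)%N.
  have := card_square_roots r; have := cardsC [set a : F | a ^+ 2 == r].
  have -> : ~: [set a : F | a ^+ 2 == r] = N by apply/setP => a; rewrite !inE.
  by move: q_ge3; move: #|[set a : F | _]| #|N| #|F| => u v w; lia.
rewrite expnS (expnS 3 n.+2); apply: leq_trans (leq_mul cN (leqnn _)) _.
rewrite -[leqLHS]mulnA -[leqRHS]mulnA; apply: leq_mul => //.
rewrite big_distrr.
apply: leq_trans (_ : \sum_(a in N) q ^ n.+1 <= _)%N; first by rewrite sum_nat_const.
rewrite [leqRHS](bigID (mem N)) /=; apply: leq_trans (leq_addr _ _).
apply: leq_sum => a; rewrite inE => ar.
apply: leq_trans (IH (r - a ^+ 2) _) _; first by rewrite subr_eq0 eq_sym.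
by rewrite leq_mul2l fiber orbT.
Qed.

End SphereCount.

(** * Antipode-free subsets and the distance graph *)

Lemma antipode_free_half (V : finZmodType) (A : {set V}) :
    (forall x, x \in A -> - x \in A) -> (forall x, x \in A -> - x != x) ->
  exists B : {set V}, [/\ B \subset A, (#|A| <= #|B| * 2)%N &
    forall x, x \in B -> - x \notin B].
Proof.
(* Of each pair [x], [- x] the member of smaller rank is kept. *)
move=> AN Ane; pose B := [set x in A | (enum_rank x < enum_rank (- x)%R)%N].
exists B; split.
- by apply/subsetP => x; rewrite inE => /andP[].
- have : A \subset B :|: [set - x | x in B].
    apply/subsetP => x xA; rewrite !inE xA /=.
    case: ltngtP => //= [lt|/val_inj/enum_rank_inj e].
      by apply/imsetP; exists (- x); rewrite ?opprK // inE AN // opprK.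
    by move: (Ane x xA); rewrite -e eqxx.
  move/subset_leq_card/leq_trans; apply; apply: leq_trans (leq_card_setU _ _) _.
  by rewrite muln2 -addnn leq_add2l leq_imset_card.
- by move=> x; rewrite !inE opprK => /andP[_ lt]; rewrite (ltnNge _ (enum_rank x)) (ltnW lt) andbF.
Qed.

Lemma exists_subset_card (T : finType) (A : {set T}) (k : nat) :
  (k <= #|A|)%N -> exists2 B : {set T}, B \subset A & #|B| = k.
Proof.
move=> kA; exists [set x in take k (enum A)].
  by apply/subsetP => x; rewrite inE => /mem_take; rewrite mem_enum.
by rewrite cardsE (card_uniqP _) ?take_uniq ?enum_uniq // size_takel // -cardE.
Qed.

(** The center for [B] comes from realizing the trace of [y @: B] on [S]. *)
Lemma shatters_ordinal (V : finType) (e : rel V) (S : {set V}) (d : nat) :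
    (d <= #|S|)%N ->
    shatters [set indicator (closed_nbhd e x) | x : V] S ->
  exists2 y : 'I_d -> V, injective y &
    forall B : {set 'I_d}, exists x, forall j, (y j \in closed_nbhd e x) = (j \in B).
Proof.
move=> dS /eqP shS; pose y (j : 'I_d) := enum_val (widen_ord dS j).
have y_inj : injective y.
  by move=> i j /enum_val_inj/(congr1 val)/= /val_inj.
exists y => // B.
have : [ffun z : {x : V | x \in S} => val z \in y @: B] \in
    [set restrict S h | h in [set indicator (closed_nbhd e x) | x : V]].
  by rewrite shS inE.
case/imsetP => _ /imsetP[x _ ->] /ffunP hx; exists x => j.
have yS : y j \in S by apply: enum_valP.
by have := hx (Sub (y j) yS); rewrite !ffunE /= => <-; rewrite mem_imset.
Qed.

Lemma sqdist_sphere (F : finFieldType) (d : nat) (x y : 'rV[F]_d) (r : F) :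
  2%:R != 0 :> F -> dotv x x = r -> dotv y y = r ->
  (sqdist x y == 2%:R * r) = (dotv x y == 0).
Proof.
move=> two0 xr yr.
have -> : sqdist x y = dotv (x - y) (x - y).
  by rewrite dotvE; apply: eq_bigr => i _; rewrite !mxE expr2.
rewrite !dotvDl !dotvDr !dotvNl !dotvNr xr yr (dotvC y x).
have -> : r + - dotv x y + (- dotv x y - - r) = 2%:R * r - 2%:R * dotv x y by ring.
by rewrite -subr_eq0 addrAC subrr add0r oppr_eq0 mulf_eq0 (negPf two0).
Qed.

(** A shattered set of more than [d] points would supply [d.+1] points, the ambient dimension,
    against [not_shattered]. *)
Lemma graph_vc_dim_sphere (F : finFieldType) (d : nat) (E : {set 'rV[F]_d.+1}) (r : F) :
    2%:R != 0 :> F -> r != 0 ->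
    (forall x, x \in E -> dotv x x = r) -> (forall x, x \in E -> - x \notin E) ->
  (graph_vc_dim (dist_graph (E := E) (2%:R * r)%R) <= d)%N.
Proof.
move=> two0 r0 nE aE; apply/bigmax_leqP => S shS; rewrite leqNgt; apply/negP => dS.
have [y y_inj yB] := shatters_ordinal dS shS.
have [c cB] := fin_all_exists yB.
apply: (@not_shattered _ _ r (mem E) r0 nE aE (val \o y) (val \o c)).
- by move=> i j /val_inj/y_inj.
- by move=> j; apply: valP.
- by move=> B; apply: valP.
- move=> B j; rewrite -cB !inE /= /dist_graph (sqdist_sphere two0 (nE _ (valP _)) (nE _ (valP _))).
  by rewrite (inj_eq val_inj) (eq_sym (y j)).
Qed.

Theorem theorem4p3 (R : realType) (d : nat) (hd : (2 <= d)%N) :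
  exists c1 c2 : R,
    [/\ 0 < c1, 0 < c2 &
      forall F : finFieldType, odd #|F| ->
      forall t : F, t != 0 ->
      exists E : {set 'rV[F]_d},
        [/\ c1 * #|F|%:R ^+ (d - 1) <= #|E|%:R,
            #|E|%:R <= c2 * #|F|%:R ^+ (d - 1) &
            (graph_vc_dim (dist_graph (E := E) t) <= d - 1)%N]].
Proof.
case: d hd => [|[|n]] // _; rewrite subn1 /=.
(* The power of 3 comes from [card_sphere_ge], the factor 2 from discarding antipodes. *)
pose K := (3 ^ n.+2 * 2)%N.
have K0 : (0 < K)%N by rewrite muln_gt0 expn_gt0.
exists K%:R^-1, 1; split; rewrite ?ltr01 ?invr_gt0 ?ltr0n // => F oddF t t0.
have two0 := odd_two_neq0 oddF.
pose r := t / 2%:R; have tr : t = 2%:R * r by rewrite mulrC divfK.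
have r0 : r != 0 by rewrite mulf_neq0 ?invr_eq0.
have [||B [BA cB aB]] := @antipode_free_half _ (sphere n.+2 r).
- by move=> x; rewrite !inE dotvNl dotvNr opprK.
- move=> x; rewrite inE => /eqP xr; apply: contraNneq r0 => xN.
  have x0 : x = 0.
    apply: (scalerI two0); rewrite scaler0 scaler_nat mulr2n.
    by rewrite -{1}xN addNr.
  by rewrite -xr x0 dotv0l.
(* Truncation gives the upper bound with constant 1, and both terms of the minimum satisfy the lower
   bound. *)
have [E EB cE] := exists_subset_card (geq_minl #|B| (#|F| ^ n.+1)).
have nE x : x \in E -> dotv x x = r.
  by move=> /(subsetP EB)/(subsetP BA); rewrite inE => /eqP.
exists E; split.
- rewrite mulrC ler_pdivrMr ?ltr0n // -natrX -natrM ler_nat cE.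
  have h := card_sphere_ge oddF n r0.
  case: (leqP #|B|) => _; last exact: leq_pmulr.
  apply: leq_trans h _; rewrite [leqRHS]mulnC /K -mulnA; apply: leq_mul => //.
  by rewrite mulnC.
- by rewrite mul1r -natrX ler_nat cE geq_minr.
- rewrite tr; apply: graph_vc_dim_sphere => // x /(subsetP EB)/aB.
  by apply: contra => /(subsetP EB).
Qed.
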